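(* Let $r \geq 2$ be an integer, let $\mathcal{F}$ be a collection of $r$-uniform hypergraphs each with at least $t$ vertices, and let $0 < p < 1$. Let $\mathcal{P}^n$ denote the set of $r$-uniform hypergraphs on a fixed $n$-vertex set that contain no induced subgraph isomorphic to a member of $\mathcal{F}$, and let $c = c(p,\mathcal{F})$ be the constant such that \[ \Pr[G(n,p) \in \mathcal{P}^n] = 2^{(-c+o(1))\binom{n}{r}} \quad (n \to \infty). \] Then for every $\epsilon > 0$ there exist $n_0$ and $\delta > 0$ (depending only on $\epsilon$, $p$, $\mathcal{F}$) such that if $\mathcal{A}$ is a collection of $r$-uniform hypergraphs on a common vertex set of size $n > n_0$ with \[ \Pr[G(n,p) \in \mathcal{A}] > 2^{(-c+\epsilon)\binom{n}{r}}, \] then some hypergraph in $\mathcal{A}$ contains at least $\delta n^t$ induced subgraphs each isomorphic to a member of $\mathcal{F}$.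
   Context: $G(n,p)$ denotes the random $r$-uniform hypergraph on $n$ (labelled) vertices in which each $r$-element subset is an edge independently with probability $p$. It is known (Alekseev; Bollobás–Thomason) that for the hereditary property $\mathcal{P}$ of containing no induced member of $\mathcal{F}$, writing $\Pr[G(n,p)\in\mathcal{P}^n] = 2^{-c_n\binom{n}{r}}$, the limit $c(p,\mathcal{F}) = \lim_{n\to\infty} c_n$ exists; this is the constant $c$ above. An induced subgraph of a hypergraph $G$ is $G[S]$ for a vertex subset $S$ (all edges of $G$ contained in $S$); distinct induced subgraphs correspond to distinct vertex subsets. *)

(* Defs.v *)
From HB Require Import structures.
From mathcomp Require Import all_boot all_order all_algebra.
From mathcomp Require Import boolp reals exp.
Set Implicit Arguments. Unset Strict Implicit. Unset Printing Implicit Defensive.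
Import Order.TTheory GRing.Theory Num.Theory.
Local Open Scope ring_scope.

Definition hgraph (n : nat) := {set {set 'I_n}}.

Definition uniform (r n : nat) (H : hgraph n) : Prop :=
  forall e, e \in H -> #|e| = r.

Definition induces_copy (n : nat) (G : hgraph n) (S : {set 'I_n})
    (m : nat) (H : hgraph m) : Prop :=
  exists f : 'I_m -> 'I_n,
    [/\ injective f, f @: [set: 'I_m] = S &
        forall e : {set 'I_m}, e \in H <-> f @: e \in G].

Definition induces_member (F : forall m : nat, hgraph m -> Prop)
    (n : nat) (G : hgraph n) (S : {set 'I_n}) : Prop :=
  exists m (H : hgraph m), F m H /\ induces_copy G S H.

Definition forbids (F : forall m : nat, hgraph m -> Prop) (n : nat)
    (G : hgraph n) : Prop :=
  forall S : {set 'I_n}, ~ induces_member F G S.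

Definition prob_Gnp (R : realType) (r n : nat) (p : R)
    (Q : hgraph n -> Prop) : R :=
  \sum_(G : hgraph n | `[< uniform r G /\ Q G >])
     p ^+ #|G| * (1 - p) ^+ ('C(n, r) - #|G|).

(* Main.v *)
Require Import Defs.
From HB Require Import structures.
From mathcomp Require Import all_boot all_order all_algebra.
From mathcomp Require Import boolp reals exp.
From mathcomp Require Import ring lra zify.
Import Order.TTheory GRing.Theory Num.Theory.
Local Open Scope ring_scope.

(* Fix a large k with Pr[G(k,p) in P^k] <= x := 2^((-c + eps/4) C(k,r)), and call a
   k-subset S of the vertices of G bad when G[S] contains a member of F.  Let
   g_S = 1 if S is good and g_S = x if S is bad, so that E g_S <= 2x.  Every r-set lies in
   d = C(n-r,k-r) of the k-sets, so Finner's inequality gives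
     E prod_S g_S^(1/d) <= (2x)^(C(n,k)/d) = (2x)^(C(n,r)/C(k,r)).
   If every G in A had at most b C(n,k) bad sets, b small, the left-hand side would be at
   least Pr[A] x^(b C(n,r)/C(k,r)), and Pr[A] <= 2^((-c + eps) C(n,r)) would follow.  So
   some G in A has order n^k bad k-sets; each contains an induced copy of a member of F, on
   at least t vertices, and one such copy lies in at most n^(k-t) of the k-sets. *)

(** * Arithmetic-geometric mean and a two-point Hoelder inequality *)

(** AM-GM for [d] numbers, namely the [y i] padded with [d - #|A|] ones, whose mean is the
    right-hand side [M]. It follows from the tangent bound [ln z <= z - 1] at each number divided by
    [M]. *)
Lemma prod_powR_le {R : realType} {I : finType} (A : {set I}) (y : I -> R) (d : nat) :
  (0 < d)%N -> (#|A| <= d)%N -> (forall i, 0 <= y i) ->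
  \prod_(i in A) y i `^ (d%:R^-1) <= 1 + (\sum_(i in A) (y i - 1)) / d%:R.
Proof.
move=> d0 Ad y0; set P := \prod_(i in A) _.
have dR : (0 : R) < d%:R by rewrite ltr0n.
have sumE : \sum_(i in A) (y i - 1) = \sum_(i in A) y i - #|A|%:R.
  by rewrite sumrB sumr_const.
set s := \sum_(i in A) (y i - 1) in sumE *; set M := 1 + s / d%:R.
have ME : d%:R * M = d%:R + s by rewrite /M; field; rewrite gt_eqF.
have AdR : (#|A|%:R : R) <= d%:R by rewrite ler_nat.
have sy0 : 0 <= \sum_(i in A) y i by apply: sumr_ge0.
have M0 : 0 <= M by rewrite -(pmulr_rge0 _ dR) ME sumE; lra.
have P0 : 0 <= P by apply: prodr_ge0 => i _; exact: powR_ge0.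
have [/eqP -> //|Pn0] := boolP (P == 0).
have yn0 i : i \in A -> 0 < y i.
  move=> iA; rewrite lt_def y0 andbT; apply: contra Pn0 => /eqP yi0.
  by rewrite /P (bigD1 i) //= yi0 powR0 ?mul0r// invr_neq0// gt_eqF.
have Mgt0 : 0 < M.
  have [/eqP A0|/set0Pn [i iA]] := boolP (A == set0).
    by rewrite /M /s A0 big_set0 mul0r addr0.
  rewrite -(pmulr_rgt0 _ dR) ME sumE (bigD1 i) //=.
  have := yn0 i iA; have : 0 <= \sum_(j in A | j != i) y j by apply: sumr_ge0.
  lra.
have lnP : P = sequences.expR ((\sum_(i in A) ln (y i)) / d%:R).
  rewrite mulr_suml expR_sum; apply: eq_bigr => i /yn0 yi.
  by rewrite mulrC /powR gt_eqF.
have ln_le (z : R) : 0 < z -> ln z <= z - 1.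
  by move=> z0; have := @le_ln1Dx R (z - 1); rewrite [1 + _]addrC subrK; apply; lra.
rewrite lnP -[leRHS]lnK ?posrE// ler_expR ler_pdivrMr//.
have : \sum_(i in A) ln (y i) <= \sum_(i in A) (ln M + (y i / M - 1)).
  apply: ler_sum => i /yn0 yi; rewrite -lerBlDl -ln_div ?posrE//.
  by apply: ln_le; rewrite divr_gt0.
move/le_trans; apply.
rewrite big_split /= sumrB -mulr_suml !sumr_const -[ln M *+ _]mulr_natr.
have -> : \sum_(i in A) y i = d%:R * M - d%:R + #|A|%:R by rewrite ME sumE; ring.
(* The tangent bound for a padding one; it enters [d - #|A|] times. *)
have := ln_le _ (divr_gt0 ltr01 Mgt0).
rewrite ln_div ?posrE// ln1 => lnM1.
have -> : (d%:R * M - d%:R + #|A|%:R) / M = d%:R - (d%:R - #|A|%:R) * (1 / M).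
  by field; rewrite gt_eqF.
set z := 1 / M in lnM1 *; set l := ln M in lnM1 *.
have : 0 <= (d%:R - #|A|%:R) * (l + z - 1) by apply: mulr_ge0; lra.
lra.
Qed.

(** Outside [A] the factors are common to both sides. On [A], divide [a i] and [b i] by their
    weighted mean [s i] and apply AM-GM to each product; the linear terms then average to zero. *)
Lemma two_point_hoelder {R : realType} {I : finType} (A B : {set I}) (a b : I -> R)
    (d : nat) (w : R) :
  0 <= w <= 1 -> (0 < d)%N -> (#|A| <= d)%N ->
  (forall i, 0 <= a i) -> (forall i, 0 <= b i) ->
  A \subset B -> (forall i, i \in B :\: A -> a i = b i) ->
  w * (\prod_(i in B) a i `^ (d%:R^-1)) + (1 - w) * (\prod_(i in B) b i `^ (d%:R^-1))
  <= \prod_(i in B) (w * a i + (1 - w) * b i) `^ (d%:R^-1).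
Proof.
move=> /andP[w0 w1] d0 Ad a0 b0 AB ab.
have dR : (0 : R) < d%:R by rewrite ltr0n.
have dN : (d%:R^-1 : R) != 0 by rewrite invr_neq0// gt_eqF.
pose s i := w * a i + (1 - w) * b i.
have s0 i : 0 <= s i by rewrite addr_ge0// mulr_ge0// subr_ge0.
have abE i : i \in B :\: A -> s i = a i by move=> iBA; rewrite /s (ab i iBA); ring.
have split (c : I -> R) :
    \prod_(i in B) c i = (\prod_(i in A) c i) * \prod_(i in B :\: A) c i.
  by rewrite (big_setID A) /= (setIidPr AB).
rewrite !split.
have -> : \prod_(i in B :\: A) b i `^ d%:R^-1 = \prod_(i in B :\: A) a i `^ d%:R^-1.
  by apply: eq_bigr => i iBA; rewrite ab.
have -> : \prod_(i in B :\: A) (w * a i + (1 - w) * b i) `^ d%:R^-1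
        = \prod_(i in B :\: A) a i `^ d%:R^-1.
  by apply: eq_bigr => i iBA; rewrite -[_ + _]/(s i) abE.
rewrite !mulrA -mulrDl; apply: ler_wpM2r.
  by apply: prodr_ge0 => i _; exact: powR_ge0.
(* A vanishing mean [s i] cannot be divided by, but it forces both terms on the left to be zero. *)
have [[i iA si0]|sN] := pselect (exists2 i, i \in A & s i = 0).
  have wa : w * a i = 0.
    have := mulr_ge0 w0 (a0 i); have : 0 <= (1 - w) * b i by rewrite mulr_ge0 ?subr_ge0.
    by move: si0; rewrite /s; lra.
  have wb : (1 - w) * b i = 0 by move: si0; rewrite /s wa add0r.
  have prod0 (u : R) (f : I -> R) : u * f i = 0 ->
      u * \prod_(j in A) f j `^ d%:R^-1 = 0.
    rewrite (bigD1 i) //= => /eqP; rewrite mulf_eq0 => /orP[/eqP->|/eqP->].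
      by rewrite mul0r.
    by rewrite powR0// mul0r mulr0.
  rewrite !prod0// addr0 prodr_ge0// => j _; exact: powR_ge0.
have sp i : i \in A -> 0 < s i.
  move=> iA; rewrite lt_def s0 andbT; apply/eqP => si; apply: sN; exists i => //.
have Ps0 : 0 < \prod_(i in A) s i `^ d%:R^-1.
  by apply: prodr_gt0 => i /sp si; exact: powR_gt0.
pose f (c : I -> R) i := if i \in A then c i / s i else 1.
have norm (c : I -> R) : (forall i, 0 <= c i) ->
    \prod_(i in A) c i `^ d%:R^-1
    <= (\prod_(i in A) s i `^ d%:R^-1) * (1 + (\sum_(i in A) (c i / s i - 1)) / d%:R).
  move=> c0.
  have -> : \prod_(i in A) c i `^ d%:R^-1
      = (\prod_(i in A) s i `^ d%:R^-1) * \prod_(i in A) (f c i) `^ d%:R^-1.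
    rewrite -big_split /=; apply: eq_bigr => i iA; rewrite /f iA -powRM ?divr_ge0//.
    by rewrite mulrC divfK// gt_eqF// sp.
  apply: ler_wpM2l; first exact: ltW.
  have f0 i : 0 <= f c i by rewrite /f; case: ifP => // iA; rewrite divr_ge0.
  apply: le_trans (prod_powR_le A (f c) d d0 Ad f0) _.
  by rewrite lerD2l; under eq_bigr => i iA do rewrite /f iA.
apply: le_trans (lerD (ler_wpM2l w0 (norm a a0)) (ler_wpM2l _ (norm b b0))) _.
  by rewrite subr_ge0.
rewrite le_eqVlt; apply/orP; left; apply/eqP.
have bal : w * (\sum_(i in A) (a i / s i - 1)) +
    (1 - w) * (\sum_(i in A) (b i / s i - 1)) = 0.
  rewrite !mulr_sumr -big_split /= big1// => i /sp si.
  have -> : w * (a i / s i - 1) + (1 - w) * (b i / s i - 1) = s i / s i - 1.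
    by rewrite /s; ring.
  by rewrite divff ?subrr// gt_eqF.
move: bal; set u := \sum_(i in A) (_ - 1); set v := \sum_(i in A) (_ - 1).
set P := \prod_(i in A) _ => bal.
transitivity (P * (1 + (w * u + (1 - w) * v) / d%:R)); first by ring.
by rewrite bal mul0r addr0 mulr1.
Qed.

(** * Product measures on subsets, integrated one coordinate at a time *)

Definition pweight {R : realType} {E : finType} (w : E -> R) (G : {set E}) : R :=
  \prod_e (if e \in G then w e else 1 - w e).

Definition expect {R : realType} {E : finType} (w : E -> R) (f : {set E} -> R) : R :=
  \sum_G pweight w G * f G.

(** The conditional expectation of [f] given all coordinates other than [e]. *)
Definition resample {R : realType} {E : finType} (w : E -> R) (e : E)
    (f : {set E} -> R) (G : {set E}) : R :=
  w e * f (e |: G) + (1 - w e) * f (G :\ e).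

(** Functional rather than probabilistic independence: no weights are involved. *)
Definition indep {R : realType} {E : finType} (e : E) (f : {set E} -> R) : Prop :=
  forall G, f (e |: G) = f (G :\ e).

Lemma expect_cst {R : realType} {E : finType} (w : E -> R) (a : R) :
  expect w (fun=> a) = a.
Proof.
rewrite /expect -mulr_suml.
have -> : \sum_G pweight w G = \prod_e (w e + (1 - w e)) by rewrite bigA_distr.
by rewrite big1 ?mul1r// => e _; rewrite addrC subrK.
Qed.

Lemma sum_setU1 {R : realType} {E : finType} (e : E) (h : {set E} -> R) :
  \sum_G h G = \sum_(G : {set E} | e \notin G) (h (e |: G) + h G).
Proof.
rewrite (bigID (fun G : {set E} => e \in G)) /= big_split /=; congr (_ + _).
rewrite (reindex_onto (fun G => e |: G) (fun G => G :\ e)) /=; last first.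
  by move=> G eG; rewrite setD1K.
apply: eq_bigl => G; rewrite setU11 /=; apply/eqP/idP => [<-|/setU1K//].
by rewrite !inE eqxx.
Qed.

(** The tower property. Pair each [G] avoiding [e] with [e |: G]: their weights share the factor [W]
    and differ only by [1 - w e] against [w e]. *)
Lemma expect_resample {R : realType} {E : finType} (w : E -> R) (e : E)
    (f : {set E} -> R) :
  expect w (resample w e f) = expect w f.
Proof.
rewrite /expect !(sum_setU1 e); apply: eq_bigr => G eG.
pose W := \prod_(x | x != e) (if x \in G then w x else 1 - w x).
have -> : pweight w (e |: G) = w e * W.
  rewrite /pweight (bigD1 e) //= setU11; congr (_ * _).
  by apply: eq_bigr => x xe; rewrite !inE (negbTE xe).
have -> : pweight w G = (1 - w e) * W.
  by rewrite /pweight (bigD1 e) //= (negbTE eG).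
have Ge : G :\ e = G by apply/setP => x; rewrite !inE; case: eqP => // ->; rewrite (negbTE eG).
rewrite /resample setUA setUid setU1K// Ge; ring.
Qed.

Lemma indepU1 {R : realType} {E : finType} (e : E) (f : {set E} -> R) (G : {set E}) :
  indep e f -> f (e |: G) = f G.
Proof.
move=> ef; have [eG|eG] := boolP (e \in G); first by rewrite (setUidPr _) ?sub1set.
rewrite ef; congr f.
by apply/setP => x; rewrite !inE; case: eqP => // ->; rewrite (negbTE eG).
Qed.

Lemma indepD1 {R : realType} {E : finType} (e : E) (f : {set E} -> R) (G : {set E}) :
  indep e f -> f (G :\ e) = f G.
Proof. by move=> ef; rewrite -ef indepU1. Qed.

Lemma resample_id {R : realType} {E : finType} (w : E -> R) (e : E)
    (f : {set E} -> R) :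
  indep e f -> resample w e f = f.
Proof. by move=> ef; apply/funext => G; rewrite /resample indepU1// indepD1//; ring. Qed.

Lemma indep_resample_eq {R : realType} {E : finType} (w : E -> R) (e : E)
    (f : {set E} -> R) :
  indep e (resample w e f).
Proof.
move=> G; rewrite /resample; congr (_ * f _ + _ * f _); apply/setP => x; rewrite !inE;
by case: eqP.
Qed.

Lemma indep_resample {R : realType} {E : finType} (w : E -> R) (e e' : E)
    (f : {set E} -> R) :
  indep e f -> indep e (resample w e' f).
Proof.
have [<- _|ee' ef G] := eqVneq e e'; first exact: indep_resample_eq.
rewrite /resample setUCA ef; congr (_ * f _ + _).
  by apply/setP => x; rewrite !inE; case: (eqVneq x e) => // ->; rewrite (negbTE ee').
rewrite -[in RHS](indepU1 e)// -[in LHS](indepU1 e)//; congr (_ * f _).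
by apply/setP => x; rewrite !inE; case: (eqVneq x e).
Qed.

(** Deleting the elements of [E] one by one takes both arguments to the empty set. *)
Lemma indep_all_cst {R : realType} {E : finType} (f : {set E} -> R) (G H : {set E}) :
  (forall e, indep e f) -> f G = f H.
Proof.
move=> fi; suff f0 (s : seq E) : forall K : {set E}, f (K :\: [set x in s]) = f K.
  by rewrite -(f0 (enum E) G) -(f0 (enum E) H); congr f; apply/setP => x;
    rewrite !inE mem_enum.
elim: s => [|e s IHs] K.
  by congr f; apply/setP => x; rewrite !inE.
rewrite -(IHs K) -(indepD1 e f (K :\: [set x in s]))//; congr f; apply/setP => x.
by rewrite !inE; case: (x == e); case: (x \in s); case: (x \in K).
Qed.

Lemma expect_resample_seq {R : realType} {E : finType} (w : E -> R) (s : seq E)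
    (f : {set E} -> R) :
  expect w (foldr (resample w) f s) = expect w f.
Proof. by elim: s => //= e s <-; rewrite expect_resample. Qed.

Lemma indep_resample_seq {R : realType} {E : finType} (w : E -> R) (s : seq E)
    (f : {set E} -> R) (e : E) :
  e \in s \/ indep e f -> indep e (foldr (resample w) f s).
Proof.
elim: s => [[]//|e' s IHs] [|ef] /=; last by apply: indep_resample; apply: IHs; right.
rewrite inE => /orP[/eqP ->|es]; first exact: indep_resample_eq.
by apply: indep_resample; apply: IHs; left.
Qed.

(** Averaging over every coordinate leaves a constant, and each averaging preserves the
    expectation. *)
Lemma resample_enum {R : realType} {E : finType} (w : E -> R) (f : {set E} -> R) :
  foldr (resample w) f (enum E) = fun=> expect w f.
Proof.
apply/funext => G; rewrite -(expect_resample_seq w (enum E)).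
rewrite -[LHS](expect_cst w); congr expect; apply/funext => H.
by apply: indep_all_cst => e; apply: indep_resample_seq; left; rewrite mem_enum.
Qed.

(** Marginals of a product measure are product measures: resampling [h e] in [G] is resampling [e]
    in the preimage, so resampling along the image of [h] already yields a constant. *)
Lemma expect_preimset {R : realType} {E E' : finType} (h : E' -> E) (w : E -> R)
    (f : {set E'} -> R) :
  injective h -> expect w (fun G => f (h @^-1: G)) = expect (w \o h) f.
Proof.
move=> hinj; rewrite -(expect_resample_seq w (map h (enum E'))).
have -> : foldr (resample w) (fun G => f (h @^-1: G)) (map h (enum E'))
        = fun G => foldr (resample (w \o h)) f (enum E') (h @^-1: G).
  elim: (enum E') => //= e s ->; apply/funext => G; rewrite /resample /=.
  have -> : h @^-1: (h e |: G) = e |: h @^-1: G.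
    by apply/setP => x; rewrite !inE (inj_eq hinj).
  have -> // : h @^-1: (G :\ h e) = h @^-1: G :\ e.
  by apply/setP => x; rewrite !inE (inj_eq hinj).
by rewrite resample_enum expect_cst.
Qed.

Lemma resample_ge0 {R : realType} {E : finType} (w : E -> R) (s : seq E)
    (f : {set E} -> R) :
  (forall e, 0 <= w e <= 1) -> (forall G, 0 <= f G) ->
  forall G, 0 <= foldr (resample w) f s G.
Proof.
move=> w01 f0; elim: s => //= e s IHs G; have /andP[w0 w1] := w01 e.
by rewrite addr_ge0 // mulr_ge0 // subr_ge0.
Qed.

(* Integrating out one coordinate at a time reduces Finner's inequality to the two-point
   Hoelder inequality. *)
Lemma finner {R : realType} {E I : finType} (w : E -> R) (B : {set I})
    (D : I -> {set E}) (g : I -> {set E} -> R) (d : nat) :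
  (forall e, 0 <= w e <= 1) -> (0 < d)%N ->
  (forall i G, 0 <= g i G) ->
  (forall i e, i \in B -> e \notin D i -> indep e (g i)) ->
  (forall e, w e != 0 -> (#|[set i in B | e \in D i]| <= d)%N) ->
  expect w (fun G => \prod_(i in B) g i G `^ (d%:R^-1))
  <= \prod_(i in B) expect w (g i) `^ (d%:R^-1).
Proof.
move=> w01 d0 g0 gD degD.
(* Stated for a partial list [s] and pointwise in [G] so that induction applies; at [enum E] both
   sides become expectations. *)
suff main (s : seq E) G :
    foldr (resample w) (fun H => \prod_(i in B) g i H `^ (d%:R^-1)) s G
    <= \prod_(i in B) foldr (resample w) (g i) s G `^ (d%:R^-1).
  have := main (enum E) set0; rewrite resample_enum.
  by under [leRHS]eq_bigr => i _ do rewrite resample_enum.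
elim: s G => //= e s IHs G; have /andP[w0 w1] := w01 e.
pose gs i := foldr (resample w) (g i) s.
have gs0 i H : 0 <= gs i H by apply: resample_ge0.
apply: (@le_trans _ _ (w e * (\prod_(i in B) gs i (e |: G) `^ (d%:R^-1))
    + (1 - w e) * \prod_(i in B) gs i (G :\ e) `^ (d%:R^-1))).
  by apply: lerD; apply: ler_wpM2l; rewrite ?subr_ge0.
(* The degree bound covers only coordinates of nonzero weight. At weight zero, resampling merely
   deletes [e], on both sides. *)
have [we0|/degD degE] := eqVneq (w e) 0.
  rewrite we0 mul0r subr0 add0r mul1r; apply: ler_prod => i _.
  by rewrite powR_ge0 /resample we0 mul0r subr0 add0r mul1r lexx.
apply: (two_point_hoelder [set i in B | e \in D i]) => //.
  by apply/subsetP => i; rewrite inE => /andP[].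
move=> i; rewrite !inE negb_and => /andP[/orP[/negbTE->//|eD] iB].
by apply: indep_resample_seq; right; apply: gD.
Qed.

Lemma pweight_ge0 {R : realType} {E : finType} (w : E -> R) (G : {set E}) :
  (forall e, 0 <= w e <= 1) -> 0 <= pweight w G.
Proof.
by move=> w01; apply: prodr_ge0 => e _; case: ifP => _; have /andP[] := w01 e; lra.
Qed.

Lemma ler_expect {R : realType} {E : finType} (w : E -> R) (f g : {set E} -> R) :
  (forall e, 0 <= w e <= 1) -> (forall G, f G <= g G) -> expect w f <= expect w g.
Proof. by move=> w01 fg; apply: ler_sum => G _; rewrite ler_wpM2l ?pweight_ge0. Qed.

(** * The random hypergraph as a product measure *)

(** The ground set is all subsets of ['I_n]; weight 0 off the [r]-sets confines the measure to
    uniform hypergraphs. *)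
Definition edge_weight {R : realType} (r : nat) (p : R) {n : nat} (e : {set 'I_n}) : R :=
  if #|e| == r then p else 0.

Lemma edge_weight_bounds {R : realType} (r : nat) (p : R) (n : nat) (e : {set 'I_n}) :
  0 <= p <= 1 -> 0 <= edge_weight r p e <= 1.
Proof. by rewrite /edge_weight; case: ifP; rewrite ?lexx ?ler01. Qed.

Lemma pweight_uniform {R : realType} (r n : nat) (p : R) (G : hgraph n) :
  uniform r G ->
  pweight (edge_weight r p) G = p ^+ #|G| * (1 - p) ^+ ('C(n, r) - #|G|).
Proof.
move=> Gr; rewrite /pweight (bigID (fun e => e \in G)) /=; congr (_ * _).
  rewrite -prodr_const; apply: eq_bigr => e eG.
  by rewrite eG /edge_weight Gr// eqxx.
have GU : G \subset [set e : {set 'I_n} | #|e| == r].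
  by apply/subsetP => e eG; rewrite inE Gr.
have <- : #|[set e : {set 'I_n} | #|e| == r] :\: G| = ('C(n, r) - #|G|)%N.
  by rewrite cardsD (setIidPr GU) card_draws card_ord.
rewrite -prodr_const [RHS]big_mkcond [LHS]big_mkcond; apply: eq_bigr => e _.
rewrite !inE /edge_weight; case: (e \in G) => //=.
by case: ifP; rewrite ?subr0.
Qed.

Lemma pweight_nonuniform {R : realType} (r n : nat) (p : R) (G : hgraph n) :
  ~ uniform r G -> pweight (edge_weight r p) G = 0.
Proof.
move=> /existsNP[e /not_implyP[eG er]].
by rewrite /pweight (bigD1 e) //= eG /edge_weight; case: eqP => // _; rewrite mul0r.
Qed.

(** Non-uniform hypergraphs have weight zero, so the sum may run over all [G]. *)
Lemma prob_GnpE {R : realType} (r n : nat) (p : R) (Q : hgraph n -> Prop) :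
  prob_Gnp r p Q = expect (edge_weight r p) (fun G => `[< Q G >]%:R).
Proof.
rewrite /prob_Gnp /expect big_mkcond; apply: eq_bigr => G _ /=.
have [Gr|Gr] := pselect (uniform r G); last first.
  by rewrite pweight_nonuniform// mul0r; case: asboolP => // -[].
rewrite pweight_uniform//; case: asboolP => [[_ /asboolP ->]|nQ]; first by rewrite mulr1.
by case: asboolP => [QG|_]; [case: nQ | rewrite mulr0].
Qed.

Lemma prob_Gnp_le1 {R : realType} (r n : nat) (p : R) (Q : hgraph n -> Prop) :
  0 <= p <= 1 -> prob_Gnp r p Q <= 1.
Proof.
move=> p01; rewrite prob_GnpE -[leRHS](expect_cst (@edge_weight R r p n)).
by apply: ler_expect => [e|G]; [exact: edge_weight_bounds | by rewrite lern1 leq_b1].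
Qed.

(** * Counting the [k]-sets above a given set *)

(** Adjoining [e] is a bijection from the [(k - #|e|)]-subsets of its complement. *)
Lemma card_supersets {T : finType} (e : {set T}) (k : nat) :
  (#|e| <= k)%N ->
  #|[set S : {set T} | (#|S| == k) && (e \subset S)]| = 'C(#|T| - #|e|, k - #|e|).
Proof.
move=> ek; have <- : #|~: e| = (#|T| - #|e|)%N by rewrite [LHS]cardsCs setCK.
rewrite -cards_draws -[RHS](card_in_imset (f := fun A => A :|: e)); last first.
  move=> A B; rewrite !inE => /andP[Ae _] /andP[Be _] /setP AB; apply/setP => x.
  have := AB x; rewrite !inE; have [xe _|_] := boolP (x \in e); last by rewrite !orbF.
  have xn (C : {set T}) : C \subset ~: e -> (x \in C) = false.
    by move=> /subsetP Ce; apply/negP => /(Ce x); rewrite inE xe.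
  by rewrite (xn A Ae) (xn B Be).
apply: eq_card => S; rewrite inE; apply/andP/imsetP => [[/eqP Sk eS]|[A]].
  exists (S :\: e); last by rewrite setUC -{1}(setIidPr eS) setID.
  by rewrite inE setDE subsetIr -setDE cardsD (setIidPr eS) Sk eqxx.
rewrite inE => /andP[Ae /eqP Ak] ->; rewrite subsetUr; split => //.
have Ae0 : A :&: e = set0 by apply/eqP; rewrite setI_eq0 disjoints_subset.
by rewrite cardsU Ae0 cards0 subn0 Ak subnK.
Qed.

(** Both sides count pairs of an [r]-set inside a [k]-set. This turns the exponent [C(n,k)/d] into
    [C(n,r)/C(k,r)]. *)
Lemma bin_trinomial (n k r : nat) :
  (r <= k)%N -> (k <= n)%N -> ('C(n, k) * 'C(k, r) = 'C(n, r) * 'C(n - r, k - r))%N.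
Proof.
move=> rk kn; have rn := leq_trans rk kn.
have f0 : (0 < r`! * ((k - r)`! * (n - k)`!))%N by rewrite !muln_gt0 !fact_gt0.
apply/eqP; rewrite -(eqn_pmul2r f0); apply/eqP.
have E : (n - r - (k - r) = n - k)%N by lia.
have {}E : ('C(n - r, k - r) * ((k - r)`! * (n - k)`!) = (n - r)`!)%N.
  by rewrite -E bin_fact// leq_sub2r.
transitivity n`!.
  by rewrite -(bin_fact kn) -(bin_fact rk); ring.
by rewrite -(bin_fact rn) -E; ring.
Qed.

(** * Restriction to [k]-sets and the resulting probability bound *)

(** For injective [f] with image [S], this is [G[S]] relabelled by ['I_k], so that all restrictions
    live in one type. *)
Definition pullback {k n : nat} (f : 'I_k -> 'I_n) (G : hgraph n) : hgraph k :=
  (fun e : {set 'I_k} => f @: e) @^-1: G.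

(** Restricting [G(n,p)] to a [k]-set gives [G(k,p)], since taking images under [f] is injective on
    edges and keeps their sizes. *)
Lemma expect_pullback {R : realType} (r k n : nat) (p : R) (f : 'I_k -> 'I_n)
    (g : hgraph k -> R) :
  injective f ->
  expect (edge_weight r p) (fun G => g (pullback f G)) = expect (edge_weight r p) g.
Proof.
move=> finj; rewrite (@expect_preimset R _ _ (fun e : {set 'I_k} => f @: e)).
  by congr expect; apply/funext => e; rewrite /edge_weight /= card_imset.
exact: imset_inj.
Qed.

Lemma pullback_forbids (F : forall m : nat, hgraph m -> Prop) (k n : nat)
    (f : 'I_k -> 'I_n) (G : hgraph n) :
  injective f -> ~ forbids F (pullback f G) ->
  exists2 T : {set 'I_n}, T \subset f @: setT & induces_member F G T.
Proof.
move=> finj /existsNP[S /contrapT[m [H [FH [h [hinj hS hH]]]]]].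
exists (f @: S); first exact/imsetS/subsetT.
exists m, H; split => //; exists (f \o h); split.
- exact: inj_comp.
- by rewrite imset_comp hS.
- move=> e; have -> : (f \o h) @: e = f @: (h @: e) by exact: imset_comp.
  by rewrite hH inE.
Qed.

Lemma card_induces_member (F : forall m : nat, hgraph m -> Prop) (n t : nat)
    (G : hgraph n) (T : {set 'I_n}) :
  (forall m (H : hgraph m), F m H -> (t <= m)%N) ->
  induces_member F G T -> (t <= #|T|)%N.
Proof.
move=> Ft [m [H [/Ft tm [f [finj <- _]]]]].
by rewrite card_imset// cardsT card_ord.
Qed.

Lemma exists_embeddings (k n : nat) :
  (k <= n)%N -> exists f : {set 'I_n} -> 'I_k -> 'I_n,
    forall S : {set 'I_n}, #|S| = k -> injective (f S) /\ f S @: setT = S.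
Proof.
move=> kn; suff /choice[f fP] : forall S : {set 'I_n}, exists g : 'I_k -> 'I_n,
    #|S| = k -> injective g /\ g @: setT = S by exists f.
move=> S.
(* The choice must be total, so sets of other sizes get an arbitrary map, available because
   [k <= n]. *)
have [Sk|] := eqVneq #|S| k; last by move=> /eqP; exists (widen_ord kn).
exists (fun i => enum_val (cast_ord (esym Sk) i)) => _; split.
  by move=> i j /enum_val_inj /cast_ord_inj.
apply/setP => x; apply/imsetP/idP => [[i _ ->]|xS]; first exact: enum_valP.
exists (cast_ord Sk (enum_rank_in xS x)) => //.
by rewrite cast_ordK enum_rankK_in.
Qed.

Lemma indep_pullback {R : realType} (k n : nat) (f : 'I_k -> 'I_n)
    (g : hgraph k -> R) (e : {set 'I_n}) :
  ~~ (e \subset f @: setT) -> indep e (fun G => g (pullback f G)).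
Proof.
move=> eS G; congr g; apply/setP => x; rewrite !inE.
case: eqP => // xe; case/negP: eS; rewrite -xe; exact/imsetS/subsetT.
Qed.

(** Finner's inequality for the functions [g], one per [k]-set. Here [b] bounds the number of bad
    sets itself, not their proportion. *)
Lemma prob_Gnp_local {R : realType} (r k n : nat) (p x b : R) (Q : hgraph k -> Prop)
    (f : {set 'I_n} -> 'I_k -> 'I_n) (A : {set hgraph n}) :
  0 <= p <= 1 -> 0 < x <= 1 -> (r <= k)%N -> (k <= n)%N ->
  (forall S : {set 'I_n}, #|S| = k -> injective (f S) /\ f S @: setT = S) ->
  prob_Gnp r p Q <= x ->
  (forall G, G \in A ->
    #|[set S : {set 'I_n} | (#|S| == k) && ~~ `[< Q (pullback (f S) G) >]]|%:R <= b) ->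
  prob_Gnp r p (fun G => G \in A) * x `^ (b / 'C(n - r, k - r)%:R)
  <= (2 * x) `^ ('C(n, k)%:R / 'C(n - r, k - r)%:R).
Proof.
move=> p01 /andP[x0 x1] rk kn fS Qx bA; set d := 'C(n - r, k - r).
have d0 : (0 < d)%N by rewrite bin_gt0; lia.
have dR : (0 : R) < d%:R by rewrite ltr0n.
pose g (H : hgraph k) : R := if `[< Q H >] then 1 else x.
pose B := [set S : {set 'I_n} | #|S| == k].
have g0 H : 0 <= g H by rewrite /g; case: ifP => // _; exact: ltW.
have ew n' (e : {set 'I_n'}) := @edge_weight_bounds R r p n' e p01.
have Eg : expect (edge_weight r p) g <= 2 * x.
  (* Pointwise, [g] is at most the indicator of [Q] plus [x]. *)
  apply: (@le_trans _ _ (prob_Gnp r p Q + x)); last by lra.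
  rewrite prob_GnpE -[X in _ + X](expect_cst (@edge_weight R r p k)).
  rewrite /expect -big_split /=; apply: ler_sum => G _; rewrite -mulrDr.
  by apply: ler_wpM2l; [exact: pweight_ge0 | rewrite /g; case: ifP => _ /=; lra].
have := @finner R _ _ (@edge_weight R r p n) B (fun S => powerset S)
  (fun S G => g (pullback (f S) G)) d (ew n) d0 (fun S G => g0 _).
have H1 S e : S \in B -> e \notin powerset S -> indep e (fun G => g (pullback (f S) G)).
  rewrite inE powersetE => /eqP/fS[_ fSS] eS; apply: indep_pullback.
  by rewrite fSS.
(* Nonzero weight means [#|e| = r], and such an [e] lies in exactly [d] of the [k]-sets. *)
have H2 e : edge_weight r p e != 0 -> (#|[set S in B | e \in powerset S]| <= d)%N.
  rewrite /edge_weight; case: (eqVneq #|e| r) => [er _|_]; last by rewrite eqxx.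
  rewrite /d -er -[n in (n - _)%N]card_ord -card_supersets ?er//.
  by apply/eq_leq/eq_card => S; rewrite !inE.
move=> /(_ H1 H2) fin.
apply: (@le_trans _ _ (expect (edge_weight r p)
    (fun G : hgraph n => \prod_(S in B) g (pullback (f S) G) `^ (d%:R^-1)))).
  rewrite prob_GnpE /expect mulr_suml; apply: ler_sum => G _; rewrite -mulrA.
  apply: ler_wpM2l; first exact: pweight_ge0.
  case: asboolP => [GA|_]; last first.
    by rewrite mul0r prodr_ge0// => S _; exact: powR_ge0.
  rewrite mul1r.
  have -> : \prod_(S in B) g (pullback (f S) G) `^ (d%:R^-1)
    = x `^ (#|[set S : {set 'I_n} | (#|S| == k) && ~~ `[< Q (pullback (f S) G) >]]|%:R
            / d%:R).
    rewrite mulrC powRrM powR_mulrn ?powR_ge0// -prodr_const.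
    rewrite [RHS]big_mkcond [LHS]big_mkcond; apply: eq_bigr => S _; rewrite !inE /g.
    by case: (#|S| == k) => //=; case: ifP => //= _; rewrite powR1.
  (* Since [x <= 1], fewer bad sets give a larger product. *)
  apply: ger_powR; first by rewrite x0.
  by rewrite ler_pM2r ?invr_gt0//; exact: bA.
apply: (le_trans fin).
have -> : (2 * x) `^ ('C(n, k)%:R / d%:R) = \prod_(S in B) (2 * x) `^ (d%:R^-1).
  rewrite prodr_const [X in _ `^ X = _]mulrC powRrM powR_mulrn ?powR_ge0//.
  by rewrite card_draws card_ord.
apply: ler_prod => S; rewrite inE => /eqP/fS[finj _].
rewrite powR_ge0 /= expect_pullback//; apply: ge0_ler_powR => //.
- by rewrite invr_ge0 ltW.
- by rewrite nnegrE; apply: sumr_ge0 => G _; rewrite mulr_ge0// pweight_ge0.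
- by rewrite nnegrE mulr_ge0// ltW.
Qed.

(** * Binomial estimates and the count of bad sets *)

Lemma bin_gt_sub (r k : nat) : (0 < r)%N -> (r <= k)%N -> (k - r < 'C(k, r))%N.
Proof.
case: r => // r _; elim: k => // k IHk; rewrite ltnS leq_eqVlt => /orP[/eqP->|rk].
  by rewrite subnn binn.
have := IHk rk; rewrite binS; have : (0 < 'C(k, r))%N by rewrite bin_gt0 ltnW.
lia.
Qed.

Lemma bin_leq_exp (n k : nat) : ('C(n, k) <= n ^ k)%N.
Proof.
apply: leq_trans (_ : n ^_ k <= _)%N; first by rewrite -bin_ffact leq_pmulr ?fact_gt0.
rewrite ffact_prod -[X in (_ ^ X)%N]card_ord -prod_nat_const.
by apply: leq_prod => i _; exact: leq_subr.
Qed.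

(** Each factor [n - i] with [i < k] of the falling factorial is at least [n / 2]. *)
Lemma exp_leq_bin (n k : nat) :
  (k.*2 <= n)%N -> (n ^ k <= 2 ^ k * k`! * 'C(n, k))%N.
Proof.
move=> kn; rewrite -mulnA [(k`! * _)%N]mulnC bin_ffact ffact_prod.
rewrite -[X in (n ^ X)%N]card_ord -[X in (2 ^ X)%N]card_ord -!prod_nat_const.
by rewrite -big_split; apply: leq_prod => i _ /=; have := ltn_ord i; lia.
Qed.

(** Double counting of pairs of a bad [k]-set and an induced member inside it. *)
Lemma card_bad_sets (F : forall m : nat, hgraph m -> Prop) (n k t : nat)
    (f : {set 'I_n} -> 'I_k -> 'I_n) (G : hgraph n) :
  (0 < n)%N -> (k <= n)%N ->
  (forall m (H : hgraph m), F m H -> (t <= m)%N) ->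
  (forall S : {set 'I_n}, #|S| = k -> injective (f S) /\ f S @: setT = S) ->
  (#|[set S : {set 'I_n} | (#|S| == k) && ~~ `[< forbids F (pullback (f S) G) >]]|
   <= #|[set T : {set 'I_n} | `[< induces_member F G T >]]| * n ^ (k - t))%N.
Proof.
move=> n0 kn Ft fS; set Bad := [set S | _]; set X := [set T | _].
pose U (T : {set 'I_n}) := [set S : {set 'I_n} | (#|S| == k) && (T \subset S)].
have BadX S : S \in Bad -> (1 <= \sum_(T in X) (S \in U T))%N.
  rewrite inE => /andP[/eqP Sk /asboolPn]; have [finj fSS] := fS S Sk.
  move=> /(pullback_forbids F k n _ _ finj)[T]; rewrite fSS => TS GT.
  have TX : T \in X by rewrite inE; apply/asboolP.
  by rewrite (bigD1 T) //= inE Sk eqxx TS.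
rewrite -sum1_card; apply: leq_trans (leq_sum _ BadX) _.
rewrite exchange_big /= -sum_nat_const; apply: leq_sum => T; rewrite inE => /asboolP GT.
have tT := card_induces_member F n t G T Ft GT.
apply: (@leq_trans #|U T|).
  by rewrite -sum1_card [leqRHS]big_mkcond /= big_mkcond; apply: leq_sum => S _;
    case: (S \in Bad); case: (S \in U T).
have [Tk|kT] := leqP #|T| k; last first.
  rewrite (_ : U T = set0) ?cards0//; apply/setP => S; rewrite !inE.
  by apply/negP => /andP[/eqP Sk /subset_leq_card]; rewrite Sk leqNgt kT.
rewrite card_supersets// card_ord; apply: leq_trans (bin_leq_exp _ _) _.
apply: (@leq_trans (n ^ (k - #|T|))); last by apply: leq_pexp2l => //; lia.
(* Monotonicity in the base is applied for a positive exponent; exponent zero is separate. *)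
by have [->//|e0] := posnP (k - #|T|)%N; rewrite leq_exp2r// leq_subr.
Qed.

(** * Choice of constants and comparison of exponents *)

Theorem theorem2 (R : realType) (r t : nat) (F : forall m : nat, hgraph m -> Prop)
    (p c : R) :
  (2 <= r)%N ->
  (forall m (H : hgraph m), F m H -> (t <= m)%N /\ uniform r H) ->
  0 < p < 1 ->
  (* c = c(p,F): Pr[G(n,p) \in P^n] = 2^((-c + o(1)) binom(n,r)) *)
  (forall eta : R, 0 < eta -> exists N : nat, forall n : nat, (N < n)%N ->
     powR 2 ((- c - eta) * 'C(n, r)%:R) <= prob_Gnp r p (@forbids F n) /\
     prob_Gnp r p (@forbids F n) <= powR 2 ((- c + eta) * 'C(n, r)%:R)) ->
  forall eps : R, 0 < eps ->
  exists (n0 : nat) (delta : R), 0 < delta /\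
    forall (n : nat) (A : {set hgraph n}), (n0 < n)%N ->
      (forall G, G \in A -> uniform r G) ->
      prob_Gnp r p (fun G => G \in A) > powR 2 ((- c + eps) * 'C(n, r)%:R) ->
      exists2 G, G \in A &
        exists X : {set {set 'I_n}},
          delta * (n%:R ^+ t) <= #|X|%:R /\
          forall S, S \in X -> induces_member F G S.
Proof.
move=> r2 FH /andP[p0 p1] cP eps eps0.
have p01 : 0 <= p <= 1 by rewrite !ltW.
have Ft m (H : hgraph m) : F m H -> (t <= m)%N by case/FH.
(* If [-c + eps >= 0], the hypothesis would put a probability above 1, so any constants serve.
   Otherwise [c > eps], which makes [a] positive. *)
have [ceps|ceps] := leP 0 (- c + eps).
  exists 0%N, 1; split=> // n A _ _ /lt_geF/negP[].
  apply: le_trans (prob_Gnp_le1 r n p _ p01) _.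
  by rewrite -[leLHS](powRr0 2) ler_powR ?ler1n// mulr_ge0.
have eta0 : 0 < eps / 4 by lra.
have [N NP] := cP _ eta0.
(* The last condition makes [C(k,r) >= 4 / eps], so the factor 2 in [2 * x] costs at most [eps / 4]
   in the final exponent. *)
have [k [Nk kr kt kb]] : exists k, [/\ N < k, r <= k, t <= k &
    Num.bound (4 / eps) <= k - r]%N.
  by exists (N + t + r + Num.bound (4 / eps)).+1; split; lia.
set K := 'C(k, r).
have K0 : (0 < K)%N by rewrite bin_gt0.
have KR : (0 : R) < K%:R by rewrite ltr0n.
have epsK : 1 <= (eps / 4) * K%:R.
  have /ltW : 4 / eps < (Num.bound (4 / eps))%:R by rewrite archi_boundP// divr_ge0// ltW.
  have : ((Num.bound (4 / eps))%:R : R) <= K%:R.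
    by rewrite ler_nat (leq_trans kb)// ltnW// bin_gt_sub// ltnW.
  move=> /(fun h g => le_trans g h) h /h; rewrite ler_pdivrMr//; lra.
pose a := c - eps / 4.
have a0 : 0 < a by rewrite /a; lra.
pose x : R := 2 `^ (- a * K%:R).
have x0 : 0 < x by exact: powR_gt0.
have x1 : x <= 1.
  rewrite -[leRHS](powRr0 2) ler_powR ?ler1n// mulNr oppr_le0; apply/ltW/mulr_gt0 => //.
have kx : prob_Gnp r p (@forbids F k) <= x.
  have [_] := NP k Nk.
  by rewrite /x (_ : - a = - c + eps / 4) // /a; ring.
(* Chosen so that [x] to the power [b * C(n,r) / C(k,r)] is exactly 2 to the power
   [-(eps / 4) * C(n,r)]. *)
pose b : R := (eps / 4) / a.
have b0 : 0 < b by exact: divr_gt0.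
have ck0 : (0 : R) < (2 ^ k * k`!)%N%:R by rewrite ltr0n muln_gt0 fact_gt0 expn_gt0.
(* [n > 2k] gives [n^k <= 2^k k! C(n,k)], hence [delta * n^k <= b * C(n,k)]. *)
exists k.*2, (b / (2 ^ k * k`!)%N%:R); split; first exact: divr_gt0.
move=> n A nk _ probA; have kn : (k <= n)%N by clear -nk; lia.
have n0 : (0 < n)%N by clear -nk; lia.
have [f fS] := exists_embeddings k n kn.
pose bad (G : hgraph n) :=
  [set S : {set 'I_n} | (#|S| == k) && ~~ `[< forbids F (pullback (f S) G) >]].
have [[G GA badG]|noG] := pselect (exists2 G, G \in A & b * 'C(n, k)%:R <= #|bad G|%:R).
  exists G => //; exists [set T : {set 'I_n} | `[< induces_member F G T >]].
  split=> [|S]; last by rewrite inE => /asboolP.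
  have nR : (0 : R) < n%:R ^+ (k - t) by rewrite exprn_gt0// ltr0n.
  (* After multiplication by [n^(k-t)] the chain is [delta * n^k <= b * C(n,k) <= #|bad G| <= #|X| *
     n^(k-t)]. *)
  rewrite -(ler_pM2r nR) -[leLHS]mulrA -exprD subnKC// mulrAC ler_pdivrMr//.
  have := card_bad_sets F n k t f G n0 kn Ft fS.
  rewrite -(ler_nat R) natrM natrX => /(le_trans badG) h.
  have := exp_leq_bin n k (ltnW nk); rewrite -(ler_nat R) natrM natrX => h'.
  apply: le_trans (ler_wpM2l (ltW b0) h') _.
  by rewrite mulrCA [leRHS]mulrC ler_wpM2l// ltW.
have noG' G : G \in A -> #|bad G|%:R <= b * 'C(n, k)%:R.
  by move=> GA; rewrite leNgt; apply/negP => /ltW h; apply: noG; exists G.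
have x01 : 0 < x <= 1 by rewrite x0.
have := prob_Gnp_local r k n p x _ (@forbids F k) f A p01 x01 kr kn fS kx noG'.
set d := 'C(n - r, k - r); set M := 'C(n, r) in probA *.
have d0 : (0 < d)%N by rewrite bin_gt0 leq_sub2r.
have dR : (0 : R) < d%:R by rewrite ltr0n.
have dM : 'C(n, k)%:R / d%:R = M%:R / K%:R :> R.
  apply/eqP; rewrite eqr_div ?(gt_eqF dR) ?(gt_eqF KR)//; apply/eqP; rewrite -[LHS]natrM -[RHS]natrM; congr _%:R.
  exact: bin_trinomial.
rewrite -mulrA dM /x -powRrM -[X in (X * _) `^ _](@powRr1 R 2)// -powRD; last first.
  by apply/implyP => _; rewrite pnatr_eq0.
rewrite -powRrM => main.
have : 2 `^ ((- c + eps) * M%:R) * 2 `^ (- a * K%:R * (b * (M%:R / K%:R)))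
    < 2 `^ ((1 + - a * K%:R) * (M%:R / K%:R)).
  by apply: lt_le_trans main; rewrite ltr_pM2r// powR_gt0.
rewrite -powRD; last by apply/implyP => _; rewrite pnatr_eq0.
(* Per unit of [C(n,r)], the left exponent is [-c + 3 eps / 4], while the right one, [1/K - a], is
   at most [-c + eps / 2]: a contradiction. *)
rewrite ltNge => /negP[]; apply: ler_powR; first by rewrite ler1n.
have -> : - a * K%:R * (b * (M%:R / K%:R)) = - (eps / 4) * M%:R.
  by rewrite /b; field; rewrite !gt_eqF.
have -> : (1 + - a * K%:R) * (M%:R / K%:R) = (1 / K%:R - a) * M%:R.
  by field; rewrite gt_eqF.
rewrite -mulrDl; apply: ler_wpM2r => //.
have : 1 / K%:R <= eps / 4 by rewrite ler_pdivrMr.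
rewrite /a; lra.
Qed.
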